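(* Let $\mathbb{K}$ be a field, let $n\geq 6$ be an integer, and let $S=\mathbb{K}[x_1,\ldots,x_n]$ be the polynomial ring in $n$ variables over $\mathbb{K}$. For each integer $i$ with $1\leq i\leq n-4$, set $u_i:=x_1x_3x_{i+4}$. Also set $$u_{n-3}:=x_1x_4x_5,\qquad u_{n-2}:=x_2x_3x_4,\qquad u_{n-1}:=x_2x_3x_6.$$ Let $I\subset S$ be the squarefree monomial ideal generated by $u_1,u_2,\ldots,u_{n-1}$, and let $g_I$ denote the normalized depth function of $I$. Then (i) $g_I(1)=1$; and (ii) $g_I(2)=n-6$. In particular, $g_I(2)=g_I(1)+n-7$.
   Context: Let $S=\mathbb{K}[x_1,\ldots,x_n]$ be a polynomial ring over a field $\mathbb{K}$ and let $I\subset S$ be a squarefree monomial ideal. For a positive integer $k$, the $k$-th squarefree power of $I$, denoted $I^{[k]}$, is the ideal of $S$ generated by the squarefree monomials belonging to $I^k$. Let $\nu(I)$ be the largest integer $k$ with $I^{[k]}\neq 0$. For each $k=1,2,\ldots,\nu(I)$, let $d_k$ be the minimum degree of the monomials belonging to $I^{[k]}$. The normalized depth function of $I$ is the function $g_I:\{1,2,\ldots,\nu(I)\}\rightarrow \mathbb{Z}_{\geq 0}$ defined by $$g_I(k)={\rm depth}(S/I^{[k]})-(d_k-1).$$ Here ${\rm depth}$ is the usual depth of a finitely generated graded $S$-module, i.e. with respect to the graded maximal ideal $(x_1,\ldots,x_n)$. *)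

(* Defs.v *)
From mathcomp Require Import all_boot all_order all_algebra.
From mathcomp Require Import boolp classical_sets.
From mathcomp Require Import mpoly.

Set Implicit Arguments.
Unset Strict Implicit.
Unset Printing Implicit Defensive.

Import GRing.Theory.

Local Open Scope classical_set_scope.
Local Open Scope ring_scope.

(* Both are 0 by convention when no largest (resp. smallest) element exists. *)
Definition largest_nat (A : set nat) : nat :=
  xget 0%N [set d | A d /\ forall e, A e -> (e <= d)%N].

Definition smallest_nat (A : set nat) : nat :=
  xget 0%N [set d | A d /\ forall e, A e -> (d <= e)%N].

Section CommutativeAlgebra.
Variable R : comNzRingType.

Definition ideal_gen (G : set R) : set R :=
  [set f | exists (r : nat) (a g : 'I_r -> R),
     (forall i, G (g i)) /\ f = \sum_i a i * g i].

Definition ideal_pow (I : set R) (k : nat) : set R :=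
  ideal_gen [set p | exists f : 'I_k -> R,
     (forall i, I (f i)) /\ p = \prod_i f i].

(* [fs] is a regular sequence on the R-module R/J. Membership in
   J + (f_1, ..., f_i) means vanishing in (R/J)/(f_1, ..., f_i)(R/J). *)
Definition regular_seq_quot (J : set R) (fs : seq R) : Prop :=
  let quo i := ideal_gen (J `|` [set` take i fs]) in
  (forall i : nat, (i < size fs)%N ->
     forall h : R, quo i (fs`_i * h) -> quo i h)
  /\ ~ quo (size fs) 1.

(* Depth of R/J with respect to the ideal m. *)
Definition depth_quot (m J : set R) : nat :=
  largest_nat [set d | exists fs : seq R,
    [/\ size fs = d, forall f, f \in fs -> m f & regular_seq_quot J fs]].

End CommutativeAlgebra.

Section SquarefreePowers.
Variables (K : fieldType) (n : nat).
Implicit Types (I : set {mpoly K[n]}) (k : nat).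

(* x_i with i running from 1 to n; the values at i = 0 and i > n are junk. *)
Definition xvar (i : nat) : {mpoly K[n]} :=
  if insub i.-1 is Some j then 'X_j else 0.

Definition graded_max_ideal : set {mpoly K[n]} :=
  ideal_gen [set p | exists j : 'I_n, p = 'X_j].

Definition squarefree_monom (m : 'X_{1..n}) : Prop :=
  forall i, (m i <= 1)%N.

Definition squarefree_power I k : set {mpoly K[n]} :=
  ideal_gen [set p | exists m : 'X_{1..n},
    [/\ squarefree_monom m, p = 'X_[m] & ideal_pow I k 'X_[m]]].

Definition nu I : nat :=
  largest_nat [set k | (0 < k)%N /\ exists2 f, squarefree_power I k f & f != 0].

Definition min_monom_deg I k : nat :=
  smallest_nat [set d | exists2 m : 'X_{1..n},
    squarefree_power I k 'X_[m] & mdeg m = d].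

(* Meaningful only for 1 <= k <= nu I. The subtractions are in the integers. *)
Definition normalized_depth I k : int :=
  (depth_quot graded_max_ideal (squarefree_power I k))%:Z
  - ((min_monom_deg I k)%:Z - 1).

End SquarefreePowers.

(* Main.v *)
Require Import Defs.
From mathcomp Require Import all_boot all_order all_algebra.
From mathcomp Require Import boolp classical_sets.
From mathcomp Require Import mpoly.
From mathcomp Require Import ring zify.

(** The squarefree monomials of I ^ 2 are multiples of x_1 ... x_6, the product
    of the only two generators with disjoint supports, x_1 x_4 x_5 and
    x_2 x_3 x_6. Hence I^[2] is principal, d_1 = 3, d_2 = 6, and the claim
    amounts to depth (S/I) = 3 and depth (S/I^[2]) = n - 1.

    Lower bounds. The sequences x_1 - x_5, x_2 - x_4, x_3 - x_6 on S/I and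
    x_1 - x_j (j = 2, ..., n) on S/I^[2] are regular. Dividing by differences of
    variables amounts to identifying these variables, so at each stage the
    quotient is again defined by monomials ([quotient_rename]), and a difference
    x_a - x_b is regular modulo a monomial ideal as soon as, for a monomial m
    outside the ideal, x_a m and x_b^k m are never both in the ideal
    ([monomial_ideal_regular_diff]).

    Upper bounds. If (x_1, ..., x_n) contains a regular sequence of length d on
    S/J, then the Koszul cohomology of the variables with coefficients in S/J
    vanishes below degree d ([koszul_exact]). The cochains used here are arbitrary
    functions on words of indices, without any alternation condition: that each f
    in (x_1, ..., x_n) acts as zero on cohomology, by contraction, is then
    immediate from the recursive definition of the differential. It remains to
    exhibit classes that survive. A product h of variables, times the decomposable
    form dual to a set of indices L, is a cocycle modulo J when h x_j lies in J
    for all j outside L ([koszul_wedge_in_ideal]).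
    - For I^[2] = (w), a regular sequence on S/(w) preceded by w is regular
      on S. With h = 1 and L the set of all indices, exactness would put 1 in
      the maximal ideal.
    - For I, take h = x_1 x_3 x_4 and L = {1, 3, 4}. In multidegree 0 this class
      is the indicator cochain of the facet {1, 3, 4} of the Stanley-Reisner
      complex of I. It is not a coboundary, because that complex contains the
      boundary of the octahedron with opposite pairs of vertices {3, 6}, {1, 5}
      and {2, 4}: a 2-cycle which contains the facet {1, 3, 4} once. *)

Set Implicit Arguments.
Unset Strict Implicit.
Unset Printing Implicit Defensive.

Import GRing.Theory.

Local Open Scope classical_set_scope.
Local Open Scope ring_scope.

(** * Largest and smallest natural numbers *)

Lemma largest_natE (A : set nat) d :
  A d -> (forall e, A e -> (e <= d)%N) -> largest_nat A = d.
Proof.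
move=> Ad ub; apply: xget_unique => // e [Ae /(_ _ Ad)]; have := ub _ Ae; lia.
Qed.

Lemma smallest_natE (A : set nat) d :
  A d -> (forall e, A e -> (d <= e)%N) -> smallest_nat A = d.
Proof.
move=> Ad lb; apply: xget_unique => // e [Ae /(_ _ Ad)]; have := lb _ Ae; lia.
Qed.

Lemma largest_nat_ge (A : set nat) k b :
  A k -> (forall e, A e -> (e <= b)%N) -> (k <= largest_nat A)%N.
Proof.
move=> Ak ub; have exA : exists k, `[<A k>] by exists k; apply/asboolP.
have ubA e : `[<A e>] -> (e <= b)%N by move/asboolP/ub.
have [d /asboolP Ad maxd] := ex_maxnP exA ubA.
rewrite (largest_natE (d := d)) //; first exact/maxd/asboolP.
by move=> e Ae; apply/maxd/asboolP.
Qed.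

(** * Ideals and weakly regular sequences *)

Section Ideals.
Variable R : comNzRingType.
Implicit Types (G J : set R) (f g h : R).

Definition is_ideal J :=
  [/\ J 0, forall f g, J f -> J g -> J (f + g) & forall a f, J f -> J (a * f)].

Lemma is_ideal_opp J f : is_ideal J -> J f -> J (- f).
Proof. by case=> [_ _ JM] Jf; rewrite -mulN1r; exact: JM. Qed.

Lemma is_ideal_sub J f g : is_ideal J -> J f -> J g -> J (f - g).
Proof.
by move=> Ji Jf Jg; case: (Ji) => _ JD _; apply: JD => //; apply: is_ideal_opp.
Qed.

Lemma is_ideal_sum J (I : Type) (r : seq I) (P : pred I) (F : I -> R) :
  is_ideal J -> (forall i, P i -> J (F i)) -> J (\sum_(i <- r | P i) F i).
Proof. by case=> J0 JD _ JF; apply: (big_ind J) => //. Qed.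

Lemma ideal_gen_is_ideal G : is_ideal (ideal_gen G).
Proof.
split.
- by exists 0%N, (fun=> 0), (fun=> 0); split; [case | rewrite big_ord0].
- move=> _ _ [r [a [g [Gg ->]]]] [r' [a' [g' [Gg' ->]]]].
  exists (r + r')%N.
  exists (fun i => match split i with inl j => a j | inr j => a' j end).
  exists (fun i => match split i with inl j => g j | inr j => g' j end).
  split; first by move=> i; case: (split i).
  rewrite big_split_ord /=; congr (_ + _); apply: eq_bigr => i _.
    by rewrite (unsplitK (inl i)).
  by rewrite (unsplitK (inr i)).
- move=> b _ [r [a [g [Gg ->]]]]; exists r, (fun i => b * a i), g.
  by split=> //; rewrite mulr_sumr; apply: eq_bigr => i _; rewrite mulrA.
Qed.

Lemma sub_ideal_gen G f : G f -> ideal_gen G f.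
Proof.
by move=> Gf; exists 1%N, (fun=> 1), (fun=> f); rewrite big_ord1 mul1r.
Qed.

Lemma ideal_gen_min G J : is_ideal J -> (forall g, G g -> J g) ->
  forall f, ideal_gen G f -> J f.
Proof.
move=> Ji GJ _ [r [a [g [Gg ->]]]].
by apply: is_ideal_sum => // i _; case: Ji => _ _; apply; apply: GJ.
Qed.

Lemma ideal_genS G J f :
  (forall g, G g -> J g) -> ideal_gen G f -> ideal_gen J f.
Proof.
move=> GJ; apply: ideal_gen_min; first exact: ideal_gen_is_ideal.
by move=> g /GJ; apply: sub_ideal_gen.
Qed.

Lemma ideal_gen_id J : is_ideal J -> ideal_gen J = J.
Proof.
move=> Ji; rewrite predeqE => f; split; last exact: sub_ideal_gen.
exact: ideal_gen_min.
Qed.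

Lemma ideal_gen_setU1 J f h :
  ideal_gen (J `|` [set f]) h <-> exists p, ideal_gen J (h - f * p).
Proof.
have [J0 JD JM] := ideal_gen_is_ideal J; split=> [|[p Jp]].
  apply: (ideal_gen_min (J := [set h | exists p, ideal_gen J (h - f * p)])).
    split=> [|g1 g2 [p1 J1] [p2 J2]|a g [p Jp]] /=.
    - by exists 0; rewrite mulr0 subr0.
    - exists (p1 + p2).
      by have -> : g1 + g2 - f * (p1 + p2) = (g1 - f * p1) + (g2 - f * p2);
        [ring | apply: JD].
    - by exists (a * p); have -> : a * g - f * (a * p) = a * (g - f * p);
        [ring | apply: JM].
  move=> g [Jg|->] /=; first by exists 0; rewrite mulr0 subr0; apply: sub_ideal_gen.
  by exists 1; rewrite mulr1 subrr.
have [_ UD UM] := ideal_gen_is_ideal (J `|` [set f]).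
have -> : h = (h - f * p) + p * f by ring.
apply: UD; first by apply: ideal_genS Jp => g; left.
by apply: UM; apply: sub_ideal_gen; right.
Qed.

(** Regularity without the condition R/(J + (fs)) != 0: this is the part that
    the vanishing of Koszul cohomology uses, and it passes to tails of [fs]. *)
Definition weakly_regular J (fs : seq R) : Prop :=
  forall i : nat, (i < size fs)%N -> forall h,
    ideal_gen (J `|` [set` take i fs]) (fs`_i * h) ->
    ideal_gen (J `|` [set` take i fs]) h.

Lemma setU_mem_cons J f (fs : seq R) :
  J `|` [set` f :: fs] = (J `|` [set f]) `|` [set` fs].
Proof.
rewrite -setUA; congr (_ `|` _); rewrite predeqE => g /=; rewrite inE.
split=> [/orP[/eqP|]|[->|->]]; [by left | by right | by rewrite eqxx |].
by rewrite orbT.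
Qed.

Lemma setU_mem_nil J : J `|` [set` [::]] = J.
Proof. by rewrite predeqE => g; split=> [[]|]; [| | left]. Qed.

Lemma weakly_regular_cons J f (fs : seq R) :
  weakly_regular J (f :: fs) <->
  (forall h, ideal_gen J (f * h) -> ideal_gen J h) /\
  weakly_regular (J `|` [set f]) fs.
Proof.
split=> [reg|[reg0 reg] [|i] /= ltn]; first split.
- by have := reg 0%N isT; rewrite /= setU_mem_nil.
- by move=> i ltn; have := reg i.+1 ltn; rewrite /= setU_mem_cons.
- by rewrite setU_mem_nil.
- by rewrite setU_mem_cons; apply: reg.
Qed.

Lemma eq_weakly_regular J J' (fs : seq R) :
  (forall f, J f -> ideal_gen J' f) -> (forall f, J' f -> ideal_gen J f) ->
  weakly_regular J fs -> weakly_regular J' fs.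
Proof.
have sub (A B D : set R) : (forall f, A f -> ideal_gen B f) ->
    forall f, ideal_gen (A `|` D) f -> ideal_gen (B `|` D) f.
  move=> AB; apply: ideal_gen_min; first exact: ideal_gen_is_ideal.
  move=> f [/AB|Df]; last by apply: sub_ideal_gen; right.
  by apply: ideal_genS => g; left.
by move=> JJ' J'J reg i lti h /(sub _ _ _ J'J) /(reg i lti) /(sub _ _ _ JJ').
Qed.

End Ideals.

Lemma is_ideal_preim (R R' : comNzRingType) (phi : {rmorphism R -> R'}) (J : set R') :
  is_ideal J -> is_ideal [set f | J (phi f)].
Proof.
case=> J0 JD JM; split=> [|f g Jf Jg|a f Jf] /=; first by rewrite rmorph0.
  by rewrite rmorphD; apply: JD.
by rewrite rmorphM; apply: JM.
Qed.

(** * Koszul cochains on words of indices *)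

Section Koszul.
Variables (R : comNzRingType) (T : Type).
Implicit Types (phi psi : T -> R) (c b : seq T -> R) (s : seq T).

(** Exterior product of the 1-form [phi] with the cochain [c], evaluated at the
    word s; for [phi] the family of variables this is the Koszul differential.
    The usual formula, the sum of (-1)^k phi(s_k) c(s without s_k), is unfolded
    along the first letter. *)
Fixpoint koszul phi c s : R :=
  if s is j :: s' then phi j * c s' - koszul phi (fun t => c (j :: t)) s' else 0.

Lemma eq_koszul phi c c' s :
  (forall t, (size t).+1 = size s -> c t = c' t) -> koszul phi c s = koszul phi c' s.
Proof.
elim: s c c' => [|j s IHs] c c' //= cc'; rewrite cc' //; congr (_ - _).
by apply: IHs => t ts; apply: cc'; rewrite /= ts.
Qed.

Lemma koszulB phi c c' s :
  koszul phi (fun t => c t - c' t) s = koszul phi c s - koszul phi c' s.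
Proof. by elim: s c c' => [|j s IHs] c c' /=; rewrite ?subrr // IHs; ring. Qed.

Lemma koszulZ phi a c s : koszul phi (fun t => a * c t) s = a * koszul phi c s.
Proof. by elim: s c => [|j s IHs] c /=; rewrite ?mulr0 // IHs; ring. Qed.

Lemma koszul_sum phi (I : Type) (r : seq I) (F : I -> seq T -> R) s :
  koszul phi (fun t => \sum_(i <- r) F i t) s = \sum_(i <- r) koszul phi (F i) s.
Proof.
elim: s F => [|j s IHs] F /=; first by rewrite big1.
by rewrite IHs mulr_sumr -sumrB.
Qed.

Lemma koszul0 phi s : koszul phi (fun=> 0) s = 0.
Proof. by elim: s => //= j s ->; rewrite mulr0 subr0. Qed.

Lemma koszul_formD phi psi c s :
  koszul (fun j => phi j + psi j) c s = koszul phi c s + koszul psi c s.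
Proof. by elim: s c => [|j s IHs] c /=; rewrite ?addr0 // IHs; ring. Qed.

Lemma koszul_formZ a phi c s :
  koszul (fun j => a * phi j) c s = a * koszul phi c s.
Proof. by elim: s c => [|j s IHs] c /=; rewrite ?mulr0 // IHs; ring. Qed.

Lemma eq_koszul_form phi psi c s : phi =1 psi -> koszul phi c s = koszul psi c s.
Proof. by move=> eqp; elim: s c => //= j s IHs c; rewrite eqp IHs. Qed.

Lemma koszul_anticomm phi psi c s :
  koszul phi (koszul psi c) s = - koszul psi (koszul phi c) s.
Proof.
elim: s c => [|j s IHs] c /=; first by rewrite oppr0.
by rewrite !koszulB !koszulZ IHs; ring.
Qed.

Lemma koszul_koszul phi c s : koszul phi (koszul phi c) s = 0.
Proof.
elim: s c => [|j s IHs] c //=.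
by rewrite koszulB koszulZ IHs; ring.
Qed.

Lemma koszul_in_ideal (J : set R) phi c s : is_ideal J ->
  (forall t, (size t).+1 = size s -> J (c t)) -> J (koszul phi c s).
Proof.
move=> Ji; have [J0 _ JM] := Ji.
elim: s c => [|j s IHs] c //= Jc; apply: is_ideal_sub => //.
  by apply: JM; apply: Jc.
by apply: IHs => t ts; apply: Jc; rewrite /= ts.
Qed.

Lemma koszul_form_in_ideal (J : set R) h phi c s : is_ideal J ->
  (forall j, J (h * phi j)) -> J (h * koszul phi c s).
Proof.
move=> Ji Jphi; have [J0 _ JM] := Ji.
elim: s c => [|j s IHs] c /=; first by rewrite mulr0.
rewrite mulrBr; apply: is_ideal_sub => //.
by rewrite mulrA mulrC; apply: JM.
Qed.

(** The Koszul cohomology of R/J vanishes in degree i < [size fs]. For the first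
    element f = sum_k a_k x_(j_k) of the sequence, contraction by a is a homotopy
    between multiplication by f and 0, so f c is the coboundary of the contracted
    cochain e modulo J. By induction e is, modulo J + (f), a coboundary plus
    f b; applying the differential and cancelling f leaves c = koszul x b. *)
Lemma koszul_exact (J : set R) (x : T -> R) (fs : seq R) :
    (forall f, f \in fs -> ideal_gen (range x) f) ->
    weakly_regular J fs ->
  forall (i : nat) c, (i < size fs)%N ->
    (forall s, size s = i.+1 -> ideal_gen J (koszul x c s)) ->
  exists b, forall s, size s = i -> ideal_gen J (c s - koszul x b s).
Proof.
elim: fs J => [|f fs IHfs] J // fsm /weakly_regular_cons[regf regfs] i c.
have Ji := ideal_gen_is_ideal J; have [J0 JD JM] := Ji.
rewrite /= ltnS => ltis dc.
have [r [a [g [gx fE]]]] := fsm _ (mem_head _ _).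
have /boolp.choice[j gE] k : exists t, g k = x t.
  by have [t _ <-] := gx k; exists t.
(* contraction of c by the coefficients of f *)
pose e s := \sum_k a k * c (j k :: s).
have de s : f * c s - koszul x e s = \sum_k a k * koszul x c (j k :: s).
  rewrite koszul_sum fE mulr_suml -sumrB; apply: eq_bigr => k _ /=.
  by rewrite koszulZ gE; ring.
have {}de s : size s = i -> ideal_gen J (f * c s - koszul x e s).
  move=> si; rewrite de; apply: is_ideal_sum => // k _; apply: JM; apply: dc.
  by rewrite /= si.
case: i => [|i] in ltis dc de *.
  exists (fun=> 0) => -[|//] _; rewrite /= subr0; apply: regf.
  by have := de [::] erefl; rewrite /= subr0.
have [|//|b1 eb1] := IHfs (J `|` [set f]) _ regfs i e ltis.
- by move=> g' g'fs; apply: fsm; rewrite inE g'fs orbT.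
- move=> s si; apply/ideal_gen_setU1; exists (c s).
  by rewrite -opprB; apply: is_ideal_opp => //; apply: de.
have /boolp.choice[b2 eb2] s : exists p, size s = i ->
    ideal_gen J (e s - koszul x b1 s - f * p).
  have [/eb1/ideal_gen_setU1[p Jp]|nsi] := EM (size s = i).
    by exists p.
  by exists 0.
exists b2 => s si; apply: regf.
have -> : f * (c s - koszul x b2 s) =
    (f * c s - koszul x e s) +
    koszul x (fun t => e t - koszul x b1 t - f * b2 t) s.
  by rewrite !koszulB koszulZ koszul_koszul; ring.
apply: JD; first exact: de.
by apply: koszul_in_ideal => // t; rewrite si => -[]; apply: eb2.
Qed.

End Koszul.

Section Wedge.
Variables (R : comNzRingType) (T : eqType).
Implicit Types (L s : seq T).

(** The product of the 1-forms dual to the letters of L. *)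
Definition wedge L : seq T -> R :=
  foldr (fun a => koszul (fun j => (j == a)%:R)) (fun=> 1) L.

Lemma koszul_wedge a L s : a \in L -> koszul (fun j => (j == a)%:R) (wedge L) s = 0.
Proof.
elim: L s => // b L IHL s; rewrite inE => /predU1P[->|aL] /=.
  exact: koszul_koszul.
rewrite koszul_anticomm -[RHS]oppr0 -(koszul0 (fun j => (j == b)%:R) s).
by congr (- _); apply: eq_koszul => t _; apply: IHL.
Qed.

Lemma koszul_notin (a : T) c s :
  a \notin s -> koszul (fun j => (j == a)%:R : R) c s = 0.
Proof.
elim: s c => // j s IHs c; rewrite inE negb_or /= eq_sym => /andP[/negPf-> aNs].
by rewrite IHs // mul0r subr0.
Qed.

Lemma wedge_diag L : uniq L -> wedge L L = 1.
Proof.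
elim: L => //= a L IHL /andP[aL uL]; rewrite eqxx mul1r koszul_notin // subr0.
exact: IHL.
Qed.

Lemma koszul_form_basis (x : T -> R) L c s : uniq L ->
  koszul x c s = \sum_(a <- L) x a * koszul (fun j => (j == a)%:R) c s
               + koszul (fun j => if j \in L then 0 else x j) c s.
Proof.
elim: L => [_|a L IHL /andP[aL uL]].
  by rewrite big_nil add0r; apply: eq_koszul_form.
rewrite big_cons IHL // [_ + \sum_(_ <- _) _]addrC -[RHS]addrA; congr (_ + _).
rewrite -koszul_formZ -koszul_formD; apply: eq_koszul_form => j.
by rewrite inE; case: eqVneq => [->|_] /=; rewrite ?(negPf aL); ring.
Qed.

(** h * [wedge L] is a cocycle modulo J: the coordinates of x along L multiply
    [wedge L] to 0, the others are multiplied into J by h. *)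
Lemma koszul_wedge_in_ideal (J : set R) h (x : T -> R) L s :
  is_ideal J -> uniq L -> (forall j, j \notin L -> J (h * x j)) ->
  J (h * koszul x (wedge L) s).
Proof.
move=> Ji uL hx; rewrite (koszul_form_basis _ _ _ uL) big_seq big1 ?add0r.
  apply: koszul_form_in_ideal => // j; case: ifPn => [_|/hx//].
  by rewrite mulr0; case: Ji.
by move=> a aL; rewrite koszul_wedge ?mulr0.
Qed.

(** The source of both upper bounds on the depth: to contradict a regular
    sequence longer than L, show that this class is not a coboundary. *)
Lemma long_regular_seq_wedge_exact (J : set R) (x : T -> R) (fs : seq R) h L :
    (forall f, f \in fs -> ideal_gen (range x) f) -> weakly_regular J fs ->
    uniq L -> (forall j, j \notin L -> ideal_gen J (h * x j)) ->
    (size L < size fs)%N ->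
  exists b, forall s, size s = size L ->
    ideal_gen J (h * wedge L s - koszul x b s).
Proof.
move=> fsm regfs uL hx ltL.
apply: (koszul_exact (c := fun s => h * wedge L s) fsm regfs ltL) => s _.
by rewrite koszulZ; apply: koszul_wedge_in_ideal => //; apply: ideal_gen_is_ideal.
Qed.

End Wedge.

(** * Monomial ideals *)

Section MonomialIdeals.
Variables (K : fieldType) (n : nat).
Local Notation S := {mpoly K[n]}.
Implicit Types (P E : 'X_{1..n} -> Prop) (m : 'X_{1..n}) (p h : S).

(** Membership is tested on the monomials of the support, so that this is an
    ideal when P is closed under multiples. *)
Definition monomial_ideal P : set S := [set p | forall m, p@_m != 0 -> P m].

Definition upclosed P := forall m m', P m -> P (m + m')%MM.

Lemma monomial_ideal_is_ideal P : upclosed P -> is_ideal (monomial_ideal P).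
Proof.
move=> Pup; split=> [m|f g Pf Pg m|a f Pf m].
- by rewrite mcoeff0 eqxx.
- rewrite mcoeffD; have [->|/Pf//] := eqVneq f@_m 0.
  by rewrite add0r; apply: Pg.
- rewrite -mcoeff_msupp => /msuppM_le /allpairsP[[m1 m2] /= [_ m2f ->]].
  by rewrite addmC; apply/Pup/Pf; rewrite -mcoeff_msupp.
Qed.

Lemma monomial_idealX P m : monomial_ideal P 'X_[m] <-> P m.
Proof.
split=> [|Pm m']; first by apply; rewrite mcoeffX eqxx oner_neq0.
by rewrite mcoeffX; case: (m =P m') => [<- //|_]; rewrite eqxx.
Qed.

Lemma monomial_ideal_min P (J : set S) : is_ideal J ->
  (forall m, P m -> J 'X_[m]) -> forall p, monomial_ideal P p -> J p.
Proof.
move=> Ji PJ p Pp; rewrite (mpolyE p) big_seq; apply: is_ideal_sum => // m mp.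
rewrite -mul_mpolyC; case: Ji => _ _; apply; apply: PJ; apply: Pp.
by rewrite -mcoeff_msupp.
Qed.

Lemma mcoeffUM (a : 'I_n) p m :
  ('X_a * p)@_m = if m a == 0%N then 0 else p@_(m - U_(a)).
Proof.
have [ma0|ma] := eqVneq (m a) 0%N.
  apply/eqP; rewrite mcoeff_eq0; apply/negP => /msuppM_le.
  case/allpairsP=> -[m1 m2] /= [/mem_msuppXP<- _ mE].
  by move: ma0; rewrite mE mnmDE mnm1E eqxx.
by rewrite -{1}(submK (m := U_(a)%MM) (m' := m)) ?lep1mP // addmC mulrC mcoeffMX.
Qed.

(** Suppose (x_a - x_b) h lies in the ideal but a monomial m of h does not.
    Outside the ideal the coefficients of x_a h and x_b h agree. Hence, as long
    as x_a m is outside the ideal, m x_a/x_b is again a monomial of h outside the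
    ideal; this stops for degree reasons at some m with x_a m in the ideal. From
    there walk back through m x_b/x_a, m x_b^2/x_a^2, ...: the hypothesis keeps
    the next multiple by x_b outside the ideal, so these monomials all occur in
    h, which is absurd once the exponent of x_a is exhausted. *)
Lemma monomial_ideal_regular_diff P (a b : 'I_n) : upclosed P -> a != b ->
    (forall m k, P (m + U_(a))%MM -> P (m + U_(b) *+ k)%MM -> P m) ->
  forall h, monomial_ideal P (('X_a - 'X_b) * h) -> monomial_ideal P h.
Proof.
move=> Pup ab Pab h Ph m0 hm0; apply: contrapT => NPm0.
have coefE m : (('X_a - 'X_b) * h)@_m =
    (if m a == 0%N then 0 else h@_(m - U_(a))) -
    (if m b == 0%N then 0 else h@_(m - U_(b))).
  by rewrite mulrBl mcoeffB !mcoeffUM.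
have coef0 m : ~ P m ->
    (if m a == 0%N then 0 else h@_(m - U_(a))) =
    (if m b == 0%N then 0 else h@_(m - U_(b))).
  move=> NPm; apply/eqP; rewrite -subr_eq0 -coefE.
  by apply: contra_notT NPm => /Ph.
have chain m1 : ~ P m1 -> P (m1 + U_(a))%MM -> forall d m k, m a = d ->
    (m + U_(a) *+ k = m1 + U_(b) *+ k)%MM -> h@_m != 0 -> False.
  move=> NPm1 Pm1a.
  have next m k : (m + U_(a) *+ k = m1 + U_(b) *+ k)%MM ->
      (m + U_(b) + U_(a) *+ k = m1 + U_(b) *+ k.+1)%MM.
    by move=> mk; rewrite addmC addmA [(_ + m)%MM]addmC mk -addmA -mulmSr.
  have stays m k : (m + U_(a) *+ k = m1 + U_(b) *+ k)%MM -> ~ P (m + U_(b))%MM.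
    move=> /next mbk /(Pup _ (U_(a) *+ k)%MM); rewrite mbk.
    by move/(Pab _ _ Pm1a).
  elim=> [|d IHd] m k ma mk hm; have := coef0 _ (stays _ _ mk);
    rewrite !mnmDE !mnm1E eqxx [b == a]eq_sym (negPf ab) ma addn0 addn1 /= addmK.
    by move=> /esym/eqP; apply/negP.
  move=> hE; apply: (IHd (m + U_(b) - U_(a))%MM k.+1); last by rewrite hE.
    by rewrite mnmBE mnmDE !mnm1E eqxx [b == a]eq_sym (negPf ab) ma addn0 subn1.
  by rewrite mulmS addmA submK ?(next _ _ mk) // lep1mP mnmDE ma.
have [N hN] : exists N, forall m, h@_m != 0 -> (mdeg m < N)%N.
  by exists (msize h) => m; rewrite -mcoeff_msupp => /msize_mdeg_lt.
have climb d : forall m, (N <= m a + d)%N -> ~ P m -> h@_m != 0 -> False.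
  elim: d => [|d IHd] m md NPm hm.
    have := hN _ hm; rewrite ltnNge => /negP; apply; apply: leq_trans md _.
    by rewrite addn0 mdegE (bigD1 a) //= leq_addr.
  have [PM|NPM] := EM (P (m + U_(a))%MM).
    by apply: (chain m NPm PM (m a) m 0%N) => //; rewrite !mulm0n.
  have := coef0 _ NPM; rewrite mnmDE mnm1E eqxx addn1 /= addmK => hE.
  move: hm; rewrite hE; case: ifP => [|Mb]; first by rewrite eqxx.
  apply: (IHd).
  - rewrite mnmBE mnmDE !mnm1E eqxx [b == a]eq_sym (negPf ab).
    by rewrite subn0 addn1 addSnnS.
  - by move/(Pup _ U_(b)%MM); rewrite submK ?lep1mP ?Mb.
by apply: (climb N m0) => //; apply: leq_addl.
Qed.

End MonomialIdeals.

(** * Identification of variables *)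

Section Words.
Variables (K : fieldType) (n : nat).
Local Notation S := {mpoly K[n]}.
Implicit Types (E : set (seq 'I_n)) (L : seq 'I_n) (m : 'X_{1..n}) (p h : S).

(** A word of indices stands for the product of its letters: the image of such a
    monomial under an identification of variables is the word mapped letterwise. *)
Definition word_mnm L : 'X_{1..n} := (\sum_(a <- L) U_(a))%MM.

Lemma word_mnmE L i : word_mnm L i = count_mem i L.
Proof.
rewrite /word_mnm mnm_sumE; elim: L => [|a L IHL]; first by rewrite big_nil.
by rewrite big_cons IHL mnm1E.
Qed.

Lemma word_mnm_leE L m : (word_mnm L <= m)%MM = all (fun a => count_mem a L <= m a)%N L.
Proof.
apply/mnm_lepP/allP => [le a _|le i]; first by rewrite -word_mnmE.
rewrite word_mnmE; have [/le//|/count_memPn->//] := boolP (i \in L).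
Qed.

Lemma word_mnm_cat L1 L2 : word_mnm (L1 ++ L2) = (word_mnm L1 + word_mnm L2)%MM.
Proof. by rewrite /word_mnm big_cat. Qed.

Lemma mpolyX_word L : 'X_[K, word_mnm L] = \prod_(a <- L) 'X_a.
Proof. by rewrite /word_mnm -mprodXE. Qed.

Definition word_multiple E (rho : 'I_n -> 'I_n) m : Prop :=
  exists2 L, E L & (word_mnm (map rho L) <= m)%MM.

Definition word_ideal E : set S := monomial_ideal (word_multiple E id).

Lemma word_multiple_upclosed E rho : upclosed (word_multiple E rho).
Proof.
move=> m m' [L EL le]; exists L => //; apply: lepm_trans le _; exact: lem_addr.
Qed.

Lemma word_ideal_is_ideal E : is_ideal (word_ideal E).
Proof. exact/monomial_ideal_is_ideal/word_multiple_upclosed. Qed.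

Lemma word_idealX E m : word_ideal E 'X_[m] <-> word_multiple E id m.
Proof. exact: monomial_idealX. Qed.

Lemma word_in_ideal E L : E L -> word_ideal E 'X_[word_mnm L].
Proof. by move=> EL; apply/word_idealX; exists L; rewrite ?map_id ?lepm_refl. Qed.

Lemma word_ideal_min E (J : set S) : is_ideal J ->
  (forall L, E L -> J 'X_[word_mnm L]) -> forall p, word_ideal E p -> J p.
Proof.
move=> Ji EJ; apply: monomial_ideal_min => // m [L /EJ JL].
by rewrite map_id => /submK <-; rewrite mpolyXD; case: Ji => _ _; apply.
Qed.

Lemma word_idealE E : word_ideal E = ideal_gen [set 'X_[K, word_mnm L] | L in E].
Proof.
rewrite predeqE => f; split.
  apply: word_ideal_min; first exact: ideal_gen_is_ideal.
  by move=> L EL; apply: sub_ideal_gen; exists L.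
apply: ideal_gen_min; first exact: word_ideal_is_ideal.
by move=> _ [L EL <-]; apply: word_in_ideal.
Qed.

Definition rename (rho : 'I_n -> 'I_n) p : S := p \mPo [tuple 'X_(rho i) | i < n].

Lemma renameX rho L : rename rho 'X_[word_mnm L] = 'X_[word_mnm (map rho L)].
Proof.
rewrite /rename !mpolyX_word rmorph_prod big_map /=; apply: eq_bigr => a _.
by rewrite /= comp_mpolyXU -tnth_nth tnth_mktuple.
Qed.

Lemma renameU rho a : rename rho 'X_a = 'X_(rho a).
Proof. by rewrite /rename comp_mpolyXU -tnth_nth tnth_mktuple. Qed.

Lemma rename_congr rho (D : set S) p :
  (forall j, ideal_gen D ('X_j - 'X_(rho j))) -> ideal_gen D (p - rename rho p).
Proof.
move=> Dj; have Di := ideal_gen_is_ideal D; have [D0 DD DM] := Di.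
have DX L : ideal_gen D ('X_[word_mnm L] - rename rho 'X_[word_mnm L]).
  rewrite renameX !mpolyX_word big_map; elim: L => [|a L IHL].
    by rewrite !big_nil subrr.
  rewrite !big_cons; set u := \prod_(_ <- _) _ in IHL *.
  set w := \prod_(_ <- _) _ in IHL *.
  have -> : 'X_a * u - 'X_(rho a) * w =
    'X_a * (u - w) + w * ('X_a - 'X_(rho a)) by ring.
  by apply: DD; apply: DM.
rewrite (mpolyE p) /rename rmorph_sum /= -sumrB; apply: is_ideal_sum => // m _.
rewrite comp_mpolyZ -scalerBr -mul_mpolyC; apply: DM.
suff [L ->] : exists L, m = word_mnm L by apply: DX.
exists (flatten [seq nseq (m i) i | i <- enum 'I_n]).
rewrite [LHS]multinomUE_id /word_mnm big_flatten big_map big_enum /=.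
apply: eq_bigr => i _; rewrite big_nseq; elim: (m i) => [|k IHk] //=.
by rewrite mulmS IHk.
Qed.

(** If the elements D generate exactly the relations x_j = x_(rho j), then modulo
    D the polynomial h may be replaced by [rename rho h] and each generator of the
    ideal by its image, so the quotient is again defined by monomials. *)
Lemma quotient_rename E rho (D : set S) h :
    (forall f, D f -> rename rho f = 0) ->
    (forall j, ideal_gen D ('X_j - 'X_(rho j))) ->
  ideal_gen (word_ideal E `|` D) h <->
  monomial_ideal (word_multiple E rho) (rename rho h).
Proof.
move=> rD Dj; set J := word_ideal E; set M := monomial_ideal _.
have Mi : is_ideal M by apply/monomial_ideal_is_ideal/word_multiple_upclosed.
have pre_i : is_ideal [set f | M (rename rho f)] by apply: is_ideal_preim.
have Gi := ideal_gen_is_ideal (J `|` D); have [G0 GD GM] := Gi.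
have congrG f : ideal_gen (J `|` D) (f - rename rho f).
  by apply: (ideal_genS (G := D)) (rename_congr _ Dj) => g; right.
split.
  apply: (ideal_gen_min pre_i) => f [Jf|/rD rf0] /=; last first.
    by rewrite rf0; case: Mi.
  apply: (word_ideal_min pre_i) Jf => L EL /=; rewrite renameX.
  by apply/monomial_idealX; exists L => //; apply: lepm_refl.
move=> Mh; have -> : h = (h - rename rho h) + rename rho h by ring.
apply: GD => //; apply: monomial_ideal_min Mh => // m [L EL] /submK <-.
rewrite mpolyXD; apply: GM; rewrite -renameX.
have -> : rename rho 'X_[word_mnm L] =
    'X_[word_mnm L] - ('X_[word_mnm L] - rename rho 'X_[word_mnm L]) by ring.
by apply: is_ideal_sub => //; apply: sub_ideal_gen; left; apply: word_in_ideal.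
Qed.

Definition collapse (ds : seq ('I_n * 'I_n)) (j : 'I_n) : 'I_n :=
  foldr (fun d r => if d.2 == j then d.1 else r) j ds.

Lemma collapse_notin ds j : j \notin unzip2 ds -> collapse ds j = j.
Proof.
elim: ds => //= d ds IHds; rewrite inE negb_or eq_sym => /andP[/negPf-> /IHds].
exact.
Qed.

Lemma collapse_mem ds j : j \in unzip2 ds -> (collapse ds j, j) \in ds.
Proof.
elim: ds => //= -[a b] ds IHds; rewrite /= !inE [j == b]eq_sym.
case: (eqVneq b j) => [->|_] /=; first by rewrite eqxx.
by move=> /IHds->; rewrite orbT.
Qed.

Lemma collapse_snd ds d : uniq (unzip2 ds) -> d \in ds -> collapse ds d.2 = d.1.
Proof.
elim: ds => //= d' ds IHds /andP[d'N u]; rewrite inE => /predU1P[->|dds].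
  by rewrite eqxx.
case: eqP => [d'd|_]; last exact: IHds.
by case/negP: d'N; rewrite d'd; apply: map_f.
Qed.

Definition diffs (ds : seq ('I_n * 'I_n)) : seq S :=
  [seq 'X_d.1 - 'X_d.2 | d <- ds].

(** When the pairs identify distinct new variables with variables that are never
    eliminated, regularity of the sequence of differences reduces to a condition
    on exponents at each stage, that of [monomial_ideal_regular_diff]. *)
Lemma weakly_regular_diffs E ds :
    uniq (unzip2 ds) -> (forall d, d \in ds -> d.1 \notin unzip2 ds) ->
    (forall i d0, (i < size ds)%N -> let d := nth d0 ds i in
       let P := word_multiple E (collapse (take i ds)) in
       forall m k, P (m + U_(d.1))%MM -> P (m + U_(d.2) *+ k)%MM -> P m) ->
  weakly_regular (word_ideal E) (diffs ds).
Proof.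
move=> uds dsN Hds i; rewrite size_map => lti h.
have [d0 _] : exists d0 : 'I_n * 'I_n, True.
  by case: ds lti {uds dsN Hds} => // d; exists d.
have us : uniq (unzip2 (take i ds)) by rewrite /unzip2 map_take; apply: take_uniq.
have sub1 j : j \notin unzip2 ds -> j \notin unzip2 (take i ds).
  by apply: contra; rewrite /unzip2 map_take; apply: mem_take.
have dds : nth d0 ds i \in ds by apply: mem_nth.
have d2N : (nth d0 ds i).2 \notin unzip2 (take i ds).
  move: uds; rewrite -{1}(cat_take_drop i ds) (drop_nth d0) //.
  rewrite /unzip2 map_cat cat_uniq /= negb_or => /and3P[_ /andP[]] //.
have m1 := collapse_notin (sub1 _ (dsN _ dds)).
have m2 := collapse_notin d2N.
have QD h' : ideal_gen (word_ideal E `|` [set` take i (diffs ds)]) h' <->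
    monomial_ideal (word_multiple E (collapse (take i ds)))
      (rename (collapse (take i ds)) h').
  apply: quotient_rename => [f|j] /=.
    rewrite -map_take => /mapP[d dds' ->].
    rewrite /rename rmorphB /= -!/(rename _ _) !renameU collapse_snd //.
    by rewrite collapse_notin ?subrr // sub1 // dsN // (mem_take dds').
  have [/collapse_mem jm|/collapse_notin->] := boolP (j \in unzip2 (take i ds)).
    rewrite -opprB; apply: is_ideal_opp; first exact: ideal_gen_is_ideal.
    apply: sub_ideal_gen => /=; rewrite -map_take.
    by apply/mapP; exists (collapse (take i ds) j, j).
  by rewrite subrr; case: (ideal_gen_is_ideal [set` take i (diffs ds)]).
move=> /QD; rewrite (nth_map d0) // {1}/rename rmorphM rmorphB /= -!/(rename _ _).
rewrite !renameU m1 m2 => Mh; apply/QD; move: Mh.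
apply: monomial_ideal_regular_diff; first exact: word_multiple_upclosed.
  by apply: contra (dsN _ dds) => /eqP->; apply: map_f.
exact: Hds.
Qed.

End Words.

Arguments word_ideal K {n} E _.

(** * Squarefree powers of monomial ideals *)

Section SquarefreePowers.
Variables (K : fieldType) (n : nat).
Implicit Types (P : 'X_{1..n} -> Prop) (m : 'X_{1..n}).
Implicit Types (E : set (seq 'I_n)) (L : seq 'I_n).

Fixpoint mono_pow P k m : Prop :=
  if k is k'.+1 then
    exists m1 m2, [/\ P m1, mono_pow P k' m2 & m = (m1 + m2)%MM]
  else True.

Lemma mono_pow_upclosed P k : upclosed P -> upclosed (mono_pow P k).
Proof.
move=> Pup; case: k => // k m m' [m1 [m2 [P1 P2 ->]]]; exists (m1 + m')%MM, m2.
by split=> //; [apply: Pup | rewrite -!addmA [(m' + _)%MM]addmC].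
Qed.

Lemma ideal_pow_mono P k p : upclosed P ->
  ideal_pow (monomial_ideal P) k p -> monomial_ideal (K := K) (mono_pow P k) p.
Proof.
move=> Pup; apply: ideal_gen_min.
  by apply: monomial_ideal_is_ideal; apply: mono_pow_upclosed.
move=> _ [f [If ->]]; elim: k f If => [|k IHk] f If //.
rewrite big_ord_recl => m; rewrite -mcoeff_msupp.
case/msuppM_le/allpairsP=> -[m1 m2] /= [m1f m2f ->]; exists m1, m2; split=> //.
  by apply: (If ord0); rewrite -mcoeff_msupp.
by apply: (IHk _ (fun i => If (lift ord0 i))); rewrite -mcoeff_msupp.
Qed.

Lemma mono_pow_mdeg P k m :
  (forall m', P m' -> (0 < mdeg m')%N) -> mono_pow P k m -> (k <= mdeg m)%N.
Proof.
move=> Pdeg; elim: k m => // k IHk _ [m1 [m2 [/Pdeg P1 /IHk P2 ->]]].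
by rewrite mdegD -add1n leq_add.
Qed.

Lemma mdeg_word L : mdeg (word_mnm L) = size L.
Proof.
by rewrite /word_mnm mdeg_sum (eq_bigr (fun=> 1%N)) ?sum1_size // => a _; rewrite mdeg1.
Qed.

Lemma squarefree_word L : uniq L -> squarefree_monom (word_mnm L).
Proof. by move=> uL i; rewrite word_mnmE count_uniq_mem // leq_b1. Qed.

Lemma word_multiple_mdeg E d m :
  (forall L, E L -> d <= size L)%N -> word_multiple E id m -> (d <= mdeg m)%N.
Proof.
move=> Ed [L /Ed dL]; rewrite map_id => /submK <-; rewrite mdegD mdeg_word.
exact: leq_trans dL (leq_addl _ _).
Qed.

Lemma squarefree_powerE E E' k :
    (forall m, squarefree_monom m -> mono_pow (word_multiple E id) k m ->
       word_multiple E' id m) ->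
    (forall L, E' L -> uniq L /\ ideal_pow (word_ideal K E) k 'X_[word_mnm L]) ->
  squarefree_power (word_ideal K E) k = word_ideal K E'.
Proof.
move=> EE' E'E; rewrite predeqE => f; split.
  apply: ideal_gen_min; first exact: word_ideal_is_ideal.
  move=> _ [m [sm -> /ideal_pow_mono Im]]; apply/word_idealX; apply: EE' => //.
  by apply/(monomial_idealX K); apply: Im; apply: word_multiple_upclosed.
rewrite word_idealE; apply: ideal_genS => _ [L /E'E[uL IL] <-].
by exists (word_mnm L); split=> //; apply: squarefree_word.
Qed.

Lemma squarefree_power1 E : (forall L, E L -> uniq L) ->
  squarefree_power (word_ideal K E) 1 = word_ideal K E.
Proof.
move=> uE; apply: squarefree_powerE => [m _ [m1 [m2 [P1 _ ->]]]|L EL].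
  exact: word_multiple_upclosed.
split; first exact: uE.
apply: sub_ideal_gen; exists (fun=> 'X_[word_mnm L]); rewrite big_ord1.
by split=> // _; apply: word_in_ideal.
Qed.

Lemma min_monom_degE (I : set {mpoly K[n]}) k E' L :
    squarefree_power I k = word_ideal K E' ->
    E' L -> (forall L', E' L' -> size L <= size L')%N ->
  min_monom_deg I k = size L.
Proof.
move=> Ik EL Emin; apply: smallest_natE; rewrite Ik.
  by exists (word_mnm L); [apply: word_in_ideal | apply: mdeg_word].
by move=> _ [m /word_idealX Pm <-]; apply: word_multiple_mdeg Pm.
Qed.

(** A monomial of I ^ k has degree at least k, and a squarefree one has degree at
    most n: this bounds the exponents k with I^[k] != 0. *)
Lemma nu_ge E k : (0 < k)%N -> (forall L, E L -> (0 < size L)%N) ->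
    (exists2 f, squarefree_power (word_ideal K E) k f & f != 0) ->
  (k <= nu (word_ideal K E))%N.
Proof.
move=> k0 E0 kf; apply: (largest_nat_ge (b := n)); first by split.
move=> e [_ [_ [[|r] [a [g [Gg ->]]]]]]; first by rewrite big_ord0 eqxx.
have [m [sm _ /ideal_pow_mono Im]] := Gg ord0 => _.
have /monomial_idealX Pm := Im (@word_multiple_upclosed _ _ _).
have /leq_trans : (e <= mdeg m)%N.
  by apply: mono_pow_mdeg Pm => m' /(word_multiple_mdeg E0).
apply; rewrite mdegE -[X in (_ <= X)%N](card_ord n) -sum1_card.
by apply: leq_sum => i _; apply: sm.
Qed.

End SquarefreePowers.

(** * Depth modulo a monomial ideal *)

Section Depth.
Variables (K : fieldType) (n : nat).
Local Notation S := {mpoly K[n]}.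
Local Notation maxI := (@graded_max_ideal K n).

Lemma graded_max_idealE : maxI = ideal_gen (range (fun j : 'I_n => 'X_j : S)).
Proof.
congr ideal_gen; rewrite predeqE => p /=.
by split=> [[j ->]|[j _ <-]]; exists j.
Qed.

Lemma graded_max_is_ideal : is_ideal maxI.
Proof. exact: ideal_gen_is_ideal. Qed.

Lemma graded_max_idealU j : maxI 'X_j.
Proof. by apply: sub_ideal_gen; exists j. Qed.

Lemma coef0_is_ideal : is_ideal [set f : S | f@_0 = 0].
Proof.
split=> [|f g f0 g0|a g g0] /=; first exact: mcoeff0.
  by rewrite mcoeffD f0 g0 addr0.
by rewrite rmorphM /= g0 mulr0.
Qed.

Lemma graded_max_ideal_coef0 f : maxI f -> f@_0 = 0.
Proof.
apply: (ideal_gen_min coef0_is_ideal) => _ [j ->] /=.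
by rewrite mcoeffX mnm1_eq0.
Qed.

Lemma graded_max_ideal1 : ~ maxI 1.
Proof.
by move/graded_max_ideal_coef0/eqP; rewrite mcoeff1 eqxx oner_eq0.
Qed.

Lemma graded_max_ideal_diffs ds f : f \in diffs K ds -> maxI f.
Proof.
case/mapP=> d _ ->; apply: is_ideal_sub; first exact: graded_max_is_ideal.
  exact: graded_max_idealU.
exact: graded_max_idealU.
Qed.

Lemma word_in_graded_max_ideal L : (0 < size L)%N -> maxI 'X_[word_mnm L].
Proof.
case: L => // a L _; rewrite mpolyX_word big_cons mulrC.
by case: graded_max_is_ideal => _ _; apply; apply: graded_max_idealU.
Qed.

Lemma depth_quotE (J : set S) (fs : seq S) :
    (forall f, J f -> maxI f) ->
    (forall f, f \in fs -> maxI f) -> weakly_regular J fs ->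
    (forall fs', (forall f, f \in fs' -> maxI f) -> weakly_regular J fs' ->
       (size fs' <= size fs)%N) ->
  depth_quot maxI J = size fs.
Proof.
move=> Jm fsm regfs ub; apply: largest_natE; last first.
  by move=> _ [fs' [<- fs'm [regfs' _]]]; exact: ub.
exists fs; split=> //; split=> //; rewrite take_size.
move/(ideal_gen_min graded_max_is_ideal)=> h; apply: graded_max_ideal1.
by apply: h => g [/Jm|/fsm].
Qed.

Lemma word_ideal_graded_max E f :
  (forall L, E L -> (0 < size L)%N) -> word_ideal K E f -> maxI f.
Proof.
move=> E0; apply: word_ideal_min; first exact: graded_max_is_ideal.
by move=> L /E0; apply: word_in_graded_max_ideal.
Qed.

End Depth.

(** The n - 1 differences x_1 - x_j form a regular sequence, because a principal
    monomial ideal stays principal when variables are identified. For the upper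
    bound, a regular sequence on S/(w) extended by w on the left is regular on S;
    if it were longer than n, exactness of the Koszul complex of the variables on
    S would put 1 in the maximal ideal. *)
Lemma depth_principal_monomial (K : fieldType) (p : nat) (L : seq 'I_p.+1) :
  (0 < size L)%N ->
  depth_quot (@graded_max_ideal K p.+1) (word_ideal K [set L]) = p.
Proof.
move=> L0; set n := p.+1.
pose ds := [seq (ord0 : 'I_n, lift ord0 j) | j <- enum 'I_p].
have uds2 : unzip2 ds = [seq lift ord0 j | j <- enum 'I_p].
  by rewrite /unzip2 -map_comp.
have sz : size (diffs K ds) = p by rewrite size_map /ds size_map size_enum_ord.
have mi := graded_max_is_ideal K n.
rewrite -[RHS]sz; apply: depth_quotE.
- by move=> f; apply: word_ideal_graded_max => _ ->.
- exact: graded_max_ideal_diffs.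
- apply: weakly_regular_diffs.
  + by rewrite uds2 map_inj_uniq ?enum_uniq //; apply: lift_inj.
  + move=> _ /mapP[j _ ->]; rewrite uds2; apply/mapP => -[k _ /=] /eqP.
    by apply/negP; apply: neq_lift.
  + move=> i d0 lti d P m k [_ -> le1] [_ -> le2]; exists L => //.
    have nd : d.1 != d.2.
      have /mapP[j _ ->] : d \in ds by apply: mem_nth.
      exact: neq_lift.
    (* the first inequality decides every exponent but that of d.1, the second
       one every exponent but that of d.2 *)
    apply/mnm_lepP => j; have := mnm_lepP le1 j; have := mnm_lepP le2 j.
    rewrite !mnmDE mulmnE !mnm1E; case: (eqVneq d.1 j) => [<-|_]; last by lia.
    by rewrite eq_sym (negPf nd); lia.
move=> fs fsm regfs; rewrite sz leqNgt; apply/negP => ltp.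
have reg0 : weakly_regular set0 ('X_[K, word_mnm L] :: fs).
  apply/weakly_regular_cons; split=> [h|].
    have Z : ideal_gen set0 = [set 0 : {mpoly K[n]}].
      rewrite predeqE => f; split=> [|->].
        apply: ideal_gen_min => //; split=> [//|f1 g1 -> ->|a f1 ->] /=.
          by rewrite addr0.
        by rewrite mulr0.
      by case: (ideal_gen_is_ideal (set0 : set {mpoly K[n]})).
    rewrite Z /= => /eqP; rewrite mulf_eq0 => /orP[|/eqP//].
    by rewrite -msupp_eq0 msuppX.
  apply: eq_weakly_regular regfs => [|_ [//|->]].
    apply: word_ideal_min; first exact: ideal_gen_is_ideal.
    by move=> _ ->; apply: sub_ideal_gen; right.
  by apply: sub_ideal_gen; apply: word_in_ideal.
have [||||b eb] := long_regular_seq_wedge_exact (x := fun j => 'X_j) (h := 1)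
  (L := enum 'I_n) _ reg0.
- by move=> f; rewrite inE -graded_max_idealE => /predU1P[->|/fsm//];
    apply: word_in_graded_max_ideal.
- exact: enum_uniq.
- by move=> j; rewrite mem_enum.
- by rewrite size_enum_ord /= ltnS.
have := eb _ erefl; rewrite wedge_diag ?enum_uniq // mulr1 => e1.
apply: (@graded_max_ideal1 K n); move: e1; set u := koszul _ _ _ => e1.
have -> : 1 = (1 - u) + u by rewrite subrK.
case: (mi) => _ mD _; apply: mD; first by apply: ideal_gen_min e1.
rewrite -[u]mul1r; apply: koszul_form_in_ideal => // j; rewrite mul1r.
exact: graded_max_idealU.
Qed.

(** * The ideal with generators u_1, ..., u_(n-1) *)

Section Example.
Variables (K : fieldType) (N : nat).
Local Notation n := N.+4.+2.
(* Indices are named from 1, while ordinals start at 0. *)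
Local Notation o1 := (@Ordinal n 0 isT).
Local Notation o2 := (@Ordinal n 1 isT).
Local Notation o3 := (@Ordinal n 2 isT).
Local Notation o4 := (@Ordinal n 3 isT).
Local Notation o5 := (@Ordinal n 4 isT).
Local Notation o6 := (@Ordinal n 5 isT).

Definition gen_words : set (seq 'I_n) :=
  [set L | (exists2 j : 'I_n, (4 <= j)%N & L = [:: o1; o3; j]) \/
           L \in [:: [:: o1; o4; o5]; [:: o2; o3; o4]; [:: o2; o3; o6]]].

Lemma gen_words_uniq L : gen_words L -> uniq L.
Proof.
case=> [[j j4 ->]|]; last by rewrite !inE => /or3P[] /eqP->.
by rewrite /= !inE -!val_eqE /=; lia.
Qed.

Lemma gen_words_size (L : seq 'I_n) : gen_words L -> size L = 3%N.
Proof. by case=> [[j j4 ->]|] //; rewrite !inE => /or3P[] /eqP->. Qed.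

(** The only way in which the exponents of x_7, ..., x_n influence membership in
    the ideal. *)
Definition tail (m : 'X_{1..n}) : bool :=
  [exists j : 'I_n, (6 <= j)%N && (0 < m j)%N].

Lemma geq5_cases (j : 'I_n) : (4 <= j)%N -> [\/ j = o5, j = o6 | (6 <= j)%N].
Proof.
move=> j4; have [j5|] := eqVneq (j : nat) 4%N; first by apply: Or31; apply: val_inj.
have [j6|] := eqVneq (j : nat) 5%N; first by move=> _; apply: Or32; apply: val_inj.
by move=> ? ?; apply: Or33; lia.
Qed.

Lemma ltn_ord_neq (a b : 'I_n) : (a < b)%N -> ((a == b) = false) * ((b == a) = false).
Proof. by move=> ltab; rewrite -!val_eqE; split; apply/eqP => /= ?; lia. Qed.

Definition diagonals : seq ('I_n * 'I_n) := [:: (o1, o5); (o2, o4); (o3, o6)].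

(** x_5 and x_6 are singled out among the x_j because the identifications below
    involve them. *)
Lemma gen_words_multiple (i : nat) m : (i <= 2)%N ->
  word_multiple gen_words (collapse (take i diagonals)) m <->
  [|| (0 < m o1)%N && (0 < m o3)%N && tail m,
      (word_mnm (map (collapse (take i diagonals)) [:: o1; o3; o5]) <= m)%MM,
      (word_mnm (map (collapse (take i diagonals)) [:: o1; o3; o6]) <= m)%MM,
      (word_mnm (map (collapse (take i diagonals)) [:: o1; o4; o5]) <= m)%MM,
      (word_mnm (map (collapse (take i diagonals)) [:: o2; o3; o4]) <= m)%MM
    | (word_mnm (map (collapse (take i diagonals)) [:: o2; o3; o6]) <= m)%MM].
Proof.
move=> lei.
have tl (j : 'I_n) : (6 <= j)%N ->
    (word_mnm (map (collapse (take i diagonals)) [:: o1; o3; j]) <= m)%MM =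
    [&& 0 < m o1, 0 < m o3 & 0 < m j]%N.
  move=> j6.
  have ne (a : 'I_n) : (a < 6)%N -> ((a == j) = false) * ((j == a) = false).
    by move=> a6; apply: ltn_ord_neq; apply: leq_trans a6 j6.
  have -> : map (collapse (take i diagonals)) [:: o1; o3; j] = [:: o1; o3; j].
    congr [:: _; _; _]; apply: collapse_notin; case: (i) lei => [|[|[|//]]] //= _;
      by rewrite !inE ?negb_or ?ne.
  by rewrite word_mnm_leE /= !(ne o1) ?(ne o3) // eqxx !addn0 andbT.
split=> [[L [[j /geq5_cases[->|->|j6] ->]|]]|].
- by move=> le; rewrite le !orbT.
- by move=> le; rewrite le !orbT.
- rewrite tl // => /and3P[-> -> mj]; apply/orP; left; apply/existsP.
  by exists j; rewrite j6.
- by rewrite !inE => /or3P[] /eqP-> le; rewrite le !orbT.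
case/orP=> [/andP[/andP[m1 m3] /existsP[j /andP[j6 mj]]]|].
  exists [:: o1; o3; j]; last by rewrite tl // m1 m3 mj.
  by left; exists j => //; apply: leq_trans j6.
case/or4P=> [le|le|le|/orP[]le].
- by exists [:: o1; o3; o5] => //; left; exists o5.
- by exists [:: o1; o3; o6] => //; left; exists o6.
- by exists [:: o1; o4; o5] => //; right; rewrite !inE eqxx.
- by exists [:: o2; o3; o4] => //; right; rewrite !inE eqxx orbT.
- by exists [:: o2; o3; o6] => //; right; rewrite !inE eqxx !orbT.
Qed.

Lemma tailD m (a : 'I_n) k : (a < 6)%N -> tail (m + U_(a) *+ k)%MM = tail m.
Proof.
move=> a6; apply: eq_existsb => j; rewrite mnmDE mulmnE mnm1E.
case: (leqP 6 j) => //= j6; rewrite ltn_ord_neq ?addn0 //.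
exact: leq_trans a6 j6.
Qed.

(** After x_5 = x_1 and x_4 = x_2 the ideal is generated by x_1^2 x_3, x_1^2 x_2,
    x_2^2 x_3, x_2 x_3 x_6 and x_1 x_3 x_j for j > 5. At each stage the condition
    of [weakly_regular_diffs] is a propositional combination of inequalities on
    the first six exponents. *)
Lemma weakly_regular_diagonals :
  weakly_regular (word_ideal K gen_words) (diffs K diagonals).
Proof.
apply: weakly_regular_diffs => // [d|].
  by rewrite !inE => /or3P[] /eqP->.
move=> i d0 lti d P m k; rewrite -[U_(d.1)%MM]mulm1n.
have [d1 d2] : (d.1 < 6)%N /\ (d.2 < 6)%N.
  by rewrite /d; case: (i) lti => [|[|[|]]].
rewrite {}/P !gen_words_multiple // !word_mnm_leE !tailD // {d1 d2}/d.
case: i lti => [|[|[|//]]] _ /=; rewrite !mnmDE !mulmnE !mnm1E /=;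
  rewrite !mul0n !mul1n !addn0 !add0n !andbT;
  move: (tail m) (m o1) (m o2) (m o3) (m o4) (m o5) (m o6);
  clear=> t a1 a2 a3 a4 a5 a6; case: t; lia.
Qed.

(** In multidegree 0 the Koszul differential is the simplicial coboundary. *)
Lemma koszul3_coef (b : seq 'I_n -> {mpoly K[n]}) p q r :
  (koszul (fun j => 'X_j) b [:: p; q; r])@_(word_mnm [:: p; q; r]) =
  (b [:: q; r])@_(word_mnm [:: q; r]) - (b [:: p; r])@_(word_mnm [:: p; r])
  + (b [:: p; q])@_(word_mnm [:: p; q]).
Proof.
have E a s t : perm_eq t (a :: s) ->
    forall g : {mpoly K[n]}, ('X_a * g)@_(word_mnm t) = g@_(word_mnm s).
  move=> pts g; rewrite mulrC /word_mnm (perm_big _ pts) big_cons.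
  exact: mcoeffMX.
rewrite /= subr0 !mcoeffB (E p [:: q; r]) // (E q [:: p; r]); last first.
  by rewrite (perm_catCA [:: p] [:: q] [:: r]).
rewrite (E r [:: p; q]); last by rewrite (perm_catC [:: p; q] [:: r]).
by ring.
Qed.

Lemma tail_word s : all (fun a : 'I_n => a < 6)%N s -> tail (word_mnm s) = false.
Proof.
move=> /allP s6; apply/existsP => -[j /andP[j6]]; rewrite word_mnmE -has_count.
by case/hasP=> a /s6 a6 /eqP aj; move: a6; rewrite aj ltnNge j6.
Qed.

Definition facet : seq 'I_n := [:: o3; o1; o4].

(** One vertex from each of the opposite pairs {3, 6}, {1, 5} and {2, 4}, always
    listed in this order: the sign of a triangle in the fundamental cycle is then
    a product of signs attached to its vertices. *)
Definition octahedron : seq (seq 'I_n) :=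
  [:: facet; [:: o3; o1; o2]; [:: o3; o5; o2]; [:: o3; o5; o4];
      [:: o6; o1; o2]; [:: o6; o1; o4]; [:: o6; o5; o2]; [:: o6; o5; o4]].

Lemma octahedron_face s :
  s \in octahedron -> ~ word_multiple gen_words id (word_mnm s).
Proof.
by rewrite !inE; do ?[case/orP=> [/eqP->|]|move/eqP->];
  move/(@gen_words_multiple 0 _ isT);
  rewrite tail_word // !word_mnm_leE /= !word_mnmE /=.
Qed.

Lemma wedge_facet s :
  s \in octahedron -> wedge {mpoly K[n]} facet s = (s == facet)%:R.
Proof.
by rewrite !inE; do ?[case/orP=> [/eqP->|]|move/eqP->]; rewrite /wedge /=; ring.
Qed.

(** If the class of [facet] multiplied by x_1 x_3 x_4 were the coboundary of b,
    then [beta p q], the coefficient of x_p x_q in b(p, q), would define a cochain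
    whose coboundary takes the value 1 at [facet] and 0 at the other faces of the
    octahedron; but the alternating sum of a coboundary over all its faces is 0. *)
Lemma depth_gen_words :
  depth_quot (@graded_max_ideal K n) (word_ideal K gen_words) = 3%N.
Proof.
rewrite -[RHS]/(size (diffs K diagonals)); apply: depth_quotE.
- by move=> f; apply: word_ideal_graded_max => L /gen_words_size ->.
- exact: graded_max_ideal_diffs.
- exact: weakly_regular_diagonals.
move=> fs fsm regfs; rewrite leqNgt; apply/negP => lt3.
have [|||b] := long_regular_seq_wedge_exact (x := fun j => 'X_j)
  (h := 'X_[word_mnm facet]) (L := facet) _ regfs _ _ lt3.
- by move=> f; rewrite -graded_max_idealE; apply: fsm.
- by [].
- move=> j jN; apply: sub_ideal_gen; rewrite -mpolyXD; apply/word_idealX.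
  have [->|j2] := eqVneq j o2.
    exists [:: o2; o3; o4]; first by right; rewrite !inE eqxx orbT.
    by apply/mnm_lepP => i; rewrite map_id mnmDE !word_mnmE mnm1E /=; lia.
  exists [:: o1; o3; j]; last first.
    by apply/mnm_lepP => i; rewrite map_id mnmDE !word_mnmE mnm1E /=; lia.
  left; exists j => //; move: jN j2; rewrite !inE !negb_or -!val_eqE /=; lia.
rewrite (ideal_gen_id (@word_ideal_is_ideal K n gen_words)) => eb.
pose beta p q := (b [:: p; q])@_(word_mnm [:: p; q]).
pose z p q r := beta q r - beta p r + beta p q.
have face p q r : [:: p; q; r] \in octahedron ->
    z p q r = ([:: p; q; r] == facet)%:R.
  move=> so; have [/eqP|/eb] := eqVneq
    (('X_[word_mnm facet] * wedge _ facet [:: p; q; r] -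
      koszul (fun j => 'X_j) b [:: p; q; r])@_(word_mnm [:: p; q; r])) 0;
    last first.
    by move/(_ erefl)/(octahedron_face so).
  rewrite mcoeffB koszul3_coef -/(beta _ _) -/(z p q r) subr_eq0 => /eqP <-.
  rewrite wedge_facet //; case: eqP => [->|_]; last by rewrite mulr0 mcoeff0.
  by rewrite mulr1 mcoeffX eqxx.
(* the alternating sum over the octahedron; the value at [facet] is 1 *)
have : z o3 o1 o4 - z o3 o1 o2 + z o3 o5 o2 - z o3 o5 o4
     + z o6 o1 o2 - z o6 o1 o4 - z o6 o5 o2 + z o6 o5 o4 = 0 by rewrite /z; ring.
rewrite !face // => /eqP; rewrite !subr0 !addr0; exact/negP/oner_neq0.
Qed.

Definition six : seq 'I_n := [:: o1; o2; o3; o4; o5; o6].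

(** Among the generators, only x_1 x_4 x_5 and x_2 x_3 x_6 are coprime. *)
Lemma squarefree_power2 :
  squarefree_power (word_ideal K gen_words) 2
  = word_ideal K [set six].
Proof.
apply: squarefree_powerE => [m sm [m1 [_ [P1 [m2 [m3 [P2 _ ->]]] mE]]]|_ ->].
  exists six => //; rewrite map_id; move: P1 P2 sm; rewrite {m}mE.
  move=> /(@gen_words_multiple 0 _ isT) P1 /(@gen_words_multiple 0 _ isT) P2 sm.
  have := sm o1; have := sm o2; have := sm o3; have := sm o4; have := sm o5.
  have := sm o6; move: P1 P2; rewrite !word_mnm_leE /= !mnmDE.
  rewrite !addn0 !add0n !andbT.
  move: (tail m1) (m1 o1) (m1 o2) (m1 o3) (m1 o4) (m1 o5) (m1 o6).
  move: (tail m2) (m2 o1) (m2 o2) (m2 o3) (m2 o4) (m2 o5) (m2 o6).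
  move: (m3 o1) (m3 o2) (m3 o3) (m3 o4) (m3 o5) (m3 o6).
  clear=> ? ? ? ? ? ? t b1 b2 b3 b4 b5 b6 t' a1 a2 a3 a4 a5 a6.
  case: t; case: t'; lia.
split=> //; apply: sub_ideal_gen.
exists (fun i : 'I_2 => if i == ord0 then 'X_[word_mnm [:: o1; o4; o5]]
                        else 'X_[word_mnm [:: o2; o3; o6]]); split.
  move=> i; case: ifP => _; apply: word_in_ideal;
    by right; rewrite !inE eqxx ?orbT.
rewrite big_ord_recl big_ord1 /= -mpolyXD -word_mnm_cat; congr 'X_[_].
by rewrite /word_mnm; apply: perm_big.
Qed.

Lemma xvarE (j : 'I_n) : xvar K n j.+1 = 'X_j.
Proof. by rewrite /xvar /= valK. Qed.

Lemma ideal_gen_u (u : nat -> {mpoly K[n]}) :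
    (forall i : nat, (1 <= i <= n - 4)%N ->
       u i = xvar K n 1 * xvar K n 3 * xvar K n (i + 4)) ->
    u (n - 3)%N = xvar K n 1 * xvar K n 4 * xvar K n 5 ->
    u (n - 2)%N = xvar K n 2 * xvar K n 3 * xvar K n 4 ->
    u (n - 1)%N = xvar K n 2 * xvar K n 3 * xvar K n 6 ->
  ideal_gen [set p | exists2 i : nat, (1 <= i <= n - 1)%N & p = u i] =
  word_ideal K gen_words.
Proof.
move=> uA u3 u2 u1.
have E3 (i j k : 'I_n) :
    'X_[K, word_mnm [:: i; j; k]] = xvar _ _ i.+1 * xvar _ _ j.+1 * xvar _ _ k.+1.
  by rewrite mpolyX_word !big_cons big_nil mulr1 mulrA !xvarE.
rewrite word_idealE; congr ideal_gen; rewrite predeqE => f.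
split=> [[i /andP[i1 ile] ->]|[L]].
  have [li|gi] := leqP i (n - 4).
    have lt : (i + 3 < n)%N by lia.
    exists [:: Ordinal (isT : 0 < n)%N; Ordinal (isT : 2 < n)%N; Ordinal lt].
      by left; exists (Ordinal lt) => //=; lia.
    by rewrite E3 uA ?i1 //= -addnS.
  have : [\/ i = n - 3, i = n - 2 | i = n - 1]%N.
    have [->|n3] := eqVneq i (n - 3)%N; first exact: Or31.
    have [->|n2] := eqVneq i (n - 2)%N; first exact: Or32.
    by apply: Or33; lia.
  case=> ->.
  - exists [:: o1; o4; o5]; first by right; rewrite !inE eqxx.
    by rewrite E3 u3.
  - exists [:: o2; o3; o4]; first by right; rewrite !inE eqxx orbT.
    by rewrite E3 u2.
  - exists [:: o2; o3; o6]; first by right; rewrite !inE eqxx !orbT.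
    by rewrite E3 u1.
case=> [[j j4 ->] <-|].
  exists (j - 3)%N; first by have := ltn_ord j; lia.
  rewrite E3 uA; last by have := ltn_ord j; lia.
  by congr (_ * xvar _ _ _); lia.
rewrite !inE => /or3P[] /eqP-> <-; rewrite E3.
- by exists (n - 3)%N => //; lia.
- by exists (n - 2)%N => //; lia.
- by exists (n - 1)%N => //; lia.
Qed.

Lemma normalized_depth_gen_words1 :
  normalized_depth (word_ideal K gen_words) 1 = 1.
Proof.
have sq1 := squarefree_power1 K gen_words_uniq.
rewrite /normalized_depth (min_monom_degE sq1 (L := [:: o1; o4; o5])).
- by rewrite sq1 depth_gen_words.
- by right; rewrite !inE eqxx.
- by move=> L' /gen_words_size ->.
Qed.

Lemma normalized_depth_gen_words2 :
  normalized_depth (word_ideal K gen_words) 2 = n%:Z - 6.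
Proof.
rewrite /normalized_depth (min_monom_degE squarefree_power2 (L := six)) //.
  by rewrite squarefree_power2 depth_principal_monomial //=; lia.
by move=> L' ->.
Qed.

Lemma nu_gen_words : (2 <= nu (word_ideal K gen_words))%N.
Proof.
apply: nu_ge => // [L /gen_words_size->//|]; exists 'X_[word_mnm six]; last first.
  by rewrite -msupp_eq0 msuppX.
by rewrite squarefree_power2; apply: word_in_ideal.
Qed.

End Example.

Theorem theorem2p2 (K : fieldType) (n : nat) (n_ge6 : (6 <= n)%N)
  (u : nat -> {mpoly K[n]})
  (u_def : let x := @xvar K n in
    [/\ forall i : nat, (1 <= i <= n - 4)%N -> u i = x 1%N * x 3%N * x (i + 4)%N,
        u (n - 3)%N = x 1%N * x 4%N * x 5%N,
        u (n - 2)%N = x 2%N * x 3%N * x 4%N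
      & u (n - 1)%N = x 2%N * x 3%N * x 6%N]) :
  let I : set {mpoly K[n]} :=
    ideal_gen [set p | exists2 i : nat, (1 <= i <= n - 1)%N & p = u i] in
  let g : nat -> int := normalized_depth I in
  [/\ (* 1 and 2 lie in the domain {1, ..., nu I} of g *)
      (2 <= nu I)%N,
      g 1%N = 1,
      g 2%N = n%:Z - 6
    & g 2%N = g 1%N + n%:Z - 7].
Proof.
move: n_ge6 u u_def; case: n => [|[|[|[|[|[|N]]]]]] // _ u [uA u3 u2 u1] I g.
have IE : I = word_ideal K (@gen_words N) by exact: ideal_gen_u.
have g1 : g 1%N = 1 by rewrite /g IE normalized_depth_gen_words1.
have g2 : g 2%N = N.+4.+2%:Z - 6 by rewrite /g IE normalized_depth_gen_words2.
split=> //; [by rewrite IE nu_gen_words | by rewrite g1 g2; lia].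
Qed.
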